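(* Let $U$ be a compact semisimple Lie group with Lie algebra $\mathfrak{u}$, let $\mathfrak{t}=i\mathfrak{h}_{\mathbb{R}}$ be the Lie algebra of a maximal torus of $U$, and let $H_0\in\mathfrak{h}_{\mathbb{R}}$. Endow the adjoint orbit $\mathrm{Ad}(U)(iH_0)$ with the Kirillov--Kostant--Souriau symplectic form. Let $L\subset U$ be a proper Lie subgroup with Lie algebra $\mathfrak{l}$ and derived algebra $\mathfrak{l}'$. Then the $L$-orbit through the origin $iH_0$ in $\mathrm{Ad}(U)(iH_0)$ is isotropic if and only if $\mathfrak{l}'\subset(iH_0)^{\perp}$.
   Context: $\langle\cdot,\cdot\rangle$ denotes the Cartan--Killing form of $\mathfrak{u}$, and $(iH_0)^\perp=\{Y\in\mathfrak{u}:\langle iH_0,Y\rangle=0\}$. The derived algebra is $\mathfrak{l}'=[\mathfrak{l},\mathfrak{l}]$. The group $L$ acts on $\mathrm{Ad}(U)(iH_0)$ by restriction of the adjoint action. The Kirillov--Kostant--Souriau form on the adjoint orbit is $\omega_x(\widetilde X(x),\widetilde Y(x))=\langle x,[X,Y]\rangle$ for $X,Y\in\mathfrak{u}$, where $\widetilde X=\mathrm{ad}(X)$ is the fundamental vector field, $\widetilde X(x)=[X,x]$. An orbit is isotropic if $\omega$ vanishes on it. Here $\mathfrak{h}_{\mathbb{R}}$ is the real subspace of the Cartan subalgebra $\mathfrak{t}_{\mathbb{C}}$ spanned by the vectors dual to the roots via the Cartan--Killing form, so that $\mathfrak{t}=i\mathfrak{h}_{\mathbb{R}}$. *)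

(* Defs.v *)
From HB Require Import structures.
From mathcomp Require Import all_boot all_order all_algebra.
From mathcomp Require Import complex ring.
From mathcomp Require Import all_classical all_reals all_analysis.

Set Implicit Arguments.
Unset Strict Implicit.
Unset Printing Implicit Defensive.

Import Order.TTheory GRing.Theory Num.Theory.
Import numFieldNormedType.Exports.

Local Open Scope classical_set_scope.
Local Open Scope ring_scope.

HB.mixin Record isLieAlgebra (F : fieldType) V of GRing.Lmodule F V := {
  lie : V -> V -> V;
  lie_linearl : forall z (a : F) x y,
    lie (a *: x + y) z = a *: lie x z + lie y z;
  lie_linearr : forall x (a : F) y z,
    lie x (a *: y + z) = a *: lie x y + lie x z;
  lie_alt : forall x, lie x x = 0;
  lie_jacobi : forall x y z,
    lie x (lie y z) + lie y (lie z x) + lie z (lie x y) = 0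
}.

#[short(type="lieAlgType")]
HB.structure Definition LieAlgebra (F : fieldType) :=
  {V of GRing.Lmodule F V & isLieAlgebra F V}.

Notation "'[lie' x , y ]" := (lie x y).

Section LieTheory.
Context {F : fieldType} {V : lieAlgType F}.
Implicit Types (x y z : V) (a : F).

Lemma lieDl x y z : [lie x + y, z] = [lie x, z] + [lie y, z].
Proof. by have := lie_linearl z 1 x y; rewrite !scale1r. Qed.

Lemma lieDr x y z : [lie x, y + z] = [lie x, y] + [lie x, z].
Proof. by have := lie_linearr x 1 y z; rewrite !scale1r. Qed.

Lemma lie0l x : [lie 0, x] = 0.
Proof. by apply: (addrI [lie 0, x]); rewrite -lieDl !addr0. Qed.

Lemma lie0r x : [lie x, 0] = 0.
Proof. by apply: (addrI [lie x, 0]); rewrite -lieDr !addr0. Qed.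

Lemma lieZl a x y : [lie a *: x, y] = a *: [lie x, y].
Proof. by have := lie_linearl y a x 0; rewrite lie0l !addr0. Qed.

Lemma lieZr a x y : [lie x, a *: y] = a *: [lie x, y].
Proof. by have := lie_linearr x a y 0; rewrite lie0r !addr0. Qed.

Lemma lieNl x y : [lie - x, y] = - [lie x, y].
Proof. by rewrite -scaleN1r lieZl scaleN1r. Qed.

Lemma lieNr x y : [lie x, - y] = - [lie x, y].
Proof. by rewrite -scaleN1r lieZr scaleN1r. Qed.

Lemma lieC x y : [lie x, y] = - [lie y, x].
Proof.
apply/eqP; rewrite -addr_eq0; apply/eqP.
by have := lie_alt (x + y); rewrite !lieDl !lieDr !lie_alt add0r addr0.
Qed.

End LieTheory.

Section LinearAlgebra.
Context {F : fieldType} {V : lmodType F}.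

Definition lspan (A : set V) : set V :=
  [set v | exists n (c : 'I_n -> F) (a : 'I_n -> V),
     (forall i, A (a i)) /\ v = \sum_i c i *: a i].

Definition subspace (W : set V) : Prop :=
  W 0 /\ forall (a : F) x y, W x -> W y -> W (a *: x + y).

Definition is_basis n (b : 'I_n -> V) : Prop :=
  forall v, exists! c : 'rV[F]_n, v = \sum_i c 0 i *: b i.

(* The trace of the matrix of an endomorphism in any finite basis; the default
   value 0 is only used on infinite-dimensional spaces. *)
Definition endo_trace (f : V -> V) : F :=
  xget 0 [set t | exists n (b : 'I_n -> V) (A : 'M[F]_n),
    [/\ is_basis b, forall j, f (b j) = \sum_i A i j *: b i & t = \tr A]].

End LinearAlgebra.

Section LieAlgebraTheory.
Context {F : fieldType} {V : lieAlgType F}.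

Definition killing (x y : V) : F := endo_trace (fun z => [lie x, [lie y, z]]).

Definition bracket_span (A B : set V) : set V :=
  lspan [set z | exists x y, [/\ A x, B y & z = [lie x, y]]].

Definition derived_algebra (A : set V) : set V := bracket_span A A.

Definition lie_ideal (I : set V) : Prop :=
  subspace I /\ forall x y, I y -> I [lie x, y].

Definition lie_solvable (I : set V) : Prop :=
  exists k, iter k derived_algebra I = [set 0].

Definition lie_semisimple : Prop :=
  forall I : set V, lie_ideal I -> lie_solvable I -> I = [set 0].

Definition killing_perp (x : V) : set V := [set y | killing x y = 0].

End LieAlgebraTheory.

Arguments lie_semisimple {F} V.

(* The pair (x, y) stands for x + i y. *)
Definition complexification (V : Type) : Type := (V * V)%type.

Section Complexification.
Context {R : rcfType}.

HB.instance Definition _ (V : lieAlgType R) :=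
  GRing.Zmodule.on (complexification V).

Section Module.
Context {V : lieAlgType R}.
Local Notation VC := (complexification V).

Definition cscale (a : R[i]) (v : VC) : VC :=
  (complex.Re a *: v.1 - complex.Im a *: v.2,
   complex.Re a *: v.2 + complex.Im a *: v.1).

Fact cscaleA a b v : cscale a (cscale b v) = cscale (a * b) v.
Proof.
case: a b v => [a a'] [b b'] [v w]; congr (_, _) => /=.
  rewrite scalerBr scalerDr !scalerA scalerBl scalerDl.
  by rewrite !opprD -!addrA; congr (_ + _); rewrite addrA [RHS]addrC.
rewrite scalerBr scalerDr !scalerA scalerBl scalerDl.
by rewrite -!addrA; congr (_ + _); rewrite addrA [RHS]addrC.
Qed.

Fact cscale1 : left_id 1 cscale.
Proof. by case=> v w; rewrite /cscale/= !scale1r !scale0r subr0 addr0. Qed.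

Fact cscaleDr : right_distributive cscale +%R.
Proof.
move=> [a a'] [v w] [v' w']; congr (_, _) => /=; rewrite !scalerDr ?opprD.
  by rewrite addrACA.
by rewrite addrACA.
Qed.

Fact cscaleDl v : {morph cscale^~ v : a b / a + b}.
Proof.
case: v => v w [a a'] [b b']; congr (_, _) => /=; rewrite !scalerDl ?opprD.
  by rewrite addrACA.
by rewrite addrACA.
Qed.

HB.instance Definition _ := GRing.Zmodule_isLmodule.Build R[i] VC
  cscaleA cscale1 cscaleDr cscaleDl.

Definition clie (v w : VC) : VC :=
  ([lie v.1, w.1] - [lie v.2, w.2], [lie v.1, w.2] + [lie v.2, w.1]).

Fact clie_linearl (u : VC) (a : R[i]) (v w : VC) :
  clie (a *: v + w) u = a *: clie v u + clie w u.
Proof.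
case: u v w a => [u u'] [v v'] [w w'] [a a']; congr (_, _) => /=.
  rewrite !(lieDl, lieZl, lieNl) scalerBr scalerDr !opprD.
  by rewrite (AC (2*1*(2*1)) ((1*4)*(5*2)*(3*6))).
rewrite !(lieDl, lieZl, lieNl) scalerBr scalerDr.
by rewrite (AC (2*1*(2*1)) ((1*4)*(5*2)*(3*6))).
Qed.

Fact clie_alt (v : VC) : clie v v = 0.
Proof.
case: v => v w; rewrite /clie/= !lie_alt subr0.
by rewrite [X in (_, X)]addrC lieC addNr.
Qed.

Fact clie_skew (v w : VC) : clie v w = - clie w v.
Proof.
case: v w => [v v'] [w w']; congr (_, _) => /=.
  by rewrite (lieC v) (lieC v') opprB opprK addrC.
by rewrite (lieC v) (lieC v') opprD addrC.
Qed.

Fact clie_linearr (u : VC) (a : R[i]) (v w : VC) :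
  clie u (a *: v + w) = a *: clie u v + clie u w.
Proof.
by rewrite clie_skew clie_linearl opprD -scalerN -!(clie_skew u).
Qed.

Fact clie_jacobi (u v w : VC) :
  clie u (clie v w) + clie v (clie w u) + clie w (clie u v) = 0.
Proof.
case: u v w => [u u'] [v v'] [w w']; congr (_, _) => /=.
  rewrite !(lieDr, lieNr) !opprD.
  rewrite (AC ((2*2)*(2*2)*(2*2))
    ((1*5*9)*(2*8*11)*(3*6*12)*(4*7*10)))/=.
  by rewrite -!opprD !lie_jacobi !subr0.
rewrite !(lieDr, lieNr).
rewrite (AC ((2*2)*(2*2)*(2*2))
  ((1*6*11)*(2*7*9)*(3*5*10)*(4*8*12))) /=.
by rewrite -!opprD !lie_jacobi subr0 !addr0.
Qed.

HB.instance Definition _ := isLieAlgebra.Build R[i] VC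
  clie_linearl clie_linearr clie_alt clie_jacobi.

End Module.
End Complexification.

Section CartanSubspace.
Context {R : rcfType} {V : lieAlgType R}.
Local Notation VC := (complexification V).

Definition complexify (x : V) : VC := (x, 0).

Definition complexify_set (t : set V) : set VC := [set v | t v.1 /\ t v.2].

(* Only the restriction of alpha to h matters; it is then automatically
   linear. *)
Definition is_root (h : set VC) (alpha : VC -> R[i]) : Prop :=
  (exists2 H, h H & alpha H != 0) /\
  exists2 X, X != 0 & forall H, h H -> [lie H, X] = alpha H *: X.

(* Hd represents alpha on h through the Killing form of the complex Lie
   algebra VC. *)
Definition dual_vector (h : set VC) (alpha : VC -> R[i]) (Hd : VC) : Prop :=
  h Hd /\ forall H, h H -> killing Hd H = alpha H.

(* h_R: the real span of the vectors dual to the roots of (VC, t + i t) *)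
Definition real_cartan (t : set V) : set VC :=
  [set H | exists n (c : 'I_n -> R) (Hd : 'I_n -> VC),
    (forall i, exists alpha, is_root (complexify_set t) alpha /\
                             dual_vector (complexify_set t) alpha (Hd i)) /\
    H = \sum_i (c i)%:C%C *: Hd i].

End CartanSubspace.

Section SmoothOn.
Context {R : realType} {V W : normedModType R}.

Fixpoint differentiable_upto (k : nat) (D : set V) (f : V -> W) : Prop :=
  if k is k'.+1 then
    (forall x, D x -> differentiable f x) /\
    forall v, differentiable_upto k' D (fun x => 'D_v f x)
  else forall x, D x -> {for x, continuous f}.

(* C^infinity on D; meant for D open *)
Definition smooth_on (D : set V) (f : V -> W) : Prop :=
  forall k, differentiable_upto k D f.

End SmoothOn.

Lemma near_eq_differentiable {R : realType} {V W : normedModType R}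
    (f g : V -> W) (x : V) :
  (\near x, f x = g x) -> differentiable f x -> differentiable g x.
Proof.
move=> fg df; have fgx : f x = g x by exact: nbhs_singleton fg.
have gE : g \o shift x = cst (g x) + 'd f x +o_ 0 id.
  apply/eqaddoP => _/posnumP[e]; rewrite -fgx.
  have /eqaddoP/(_ _ [gt0 of e%:num]) nf := diff_locally df.
  have nfg : \forall h \near (0 : V), f (h + x) = g (h + x).
    by move: fg; rewrite (near_shift 0) subr0.
  apply: filterS2 nfg nf => h /= nh.
  rewrite -[X in `|X| <= _ -> _]/(f (h + x) - (cst (f x) + 'd f x) h) nh.
  exact.
have dgE := diff_unique (diff_continuous df) gE.
by apply/diff_locallyP; rewrite dgE; split=> //; exact: diff_continuous.
Qed.

Section SmoothOnTheory.
Context {R : realType} {V : normedModType R}.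
Implicit Types (D : set V) (f g : V -> R).

Lemma differentiable_upto_ext k D f g : open D ->
  (forall x, D x -> f x = g x) ->
  differentiable_upto k D f -> differentiable_upto k D g.
Proof.
move=> oD; elim: k f g => [|k IH] f g fg /=.
  move=> cf x Dx; have nfg : \near x, f x = g x.
    by near=> y; apply: fg; near: y; exact: open_nbhs_nbhs.
  suff : g y @[y --> x] --> f x by rewrite fg.
  exact: (cvg_trans (near_eq_cvg nfg) (cf _ Dx)).
move=> [df Df]; split=> [x Dx|v].
  apply: near_eq_differentiable (df _ Dx).
  by near=> y; apply: fg; near: y; exact: open_nbhs_nbhs.
apply: IH (Df v) => x Dx; apply: near_eq_derive.
by near=> y; apply: fg; near: y; exact: open_nbhs_nbhs.
Unshelve. all: by end_near. Qed.

Lemma differentiable_uptoW k D f :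
  differentiable_upto k.+1 D f -> differentiable_upto k D f.
Proof.
elim: k f => [|k IH] f /= [df Df].
  by move=> x /df; exact: differentiable_continuous.
by split=> // v; apply: IH; exact: Df.
Qed.

Lemma differentiable_upto_cst k D (a : R) : differentiable_upto k D (cst a).
Proof.
elim: k a => [|k IH] a /=; first by move=> x _; exact: cst_continuous.
split=> [x _|v]; first exact: differentiable_cst.
have -> : (fun x => 'D_v (cst a) x) = cst 0 :> (V -> R).
  by apply/funext => x; rewrite derive_cst.
exact: IH.
Qed.

Lemma differentiable_uptoD k D f g : open D ->
  differentiable_upto k D f -> differentiable_upto k D g ->
  differentiable_upto k D (f + g).
Proof.
move=> oD; elim: k f g => [|k IH] f g /=.
  by move=> cf cg x Dx; apply: continuousD; [exact: cf|exact: cg].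
move=> [df Df] [dg Dg]; split=> [x Dx|v].
  by apply: differentiableD; [exact: df|exact: dg].
apply: (differentiable_upto_ext oD _ (IH _ _ (Df v) (Dg v))) => x Dx.
by rewrite deriveD//; apply: diff_derivable; [exact: df|exact: dg].
Qed.

Lemma differentiable_uptoM k D f g : open D ->
  differentiable_upto k D f -> differentiable_upto k D g ->
  differentiable_upto k D (f * g).
Proof.
move=> oD; elim: k f g => [|k IH] f g.
  by move=> /= cf cg x Dx; apply: continuousM; [exact: cf|exact: cg].
move=> kf kg; have kf' := differentiable_uptoW kf.
have kg' := differentiable_uptoW kg.
case: kf kg => [df Df] [dg Dg]; split=> [x Dx|v].
  by apply: differentiableM; [exact: df|exact: dg].
apply: (differentiable_upto_ext oD _
  (differentiable_uptoD oD (IH _ _ kf' (Dg v)) (IH _ _ kg' (Df v)))) => x Dx.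
by rewrite deriveM//; apply: diff_derivable; [exact: df|exact: dg].
Qed.

Lemma smooth_on_cst D (a : R) : smooth_on D (cst a).
Proof. by move=> k; exact: differentiable_upto_cst. Qed.

Lemma smooth_onD D f g : open D ->
  smooth_on D f -> smooth_on D g -> smooth_on D (f + g).
Proof. by move=> oD sf sg k; exact: differentiable_uptoD. Qed.

Lemma smooth_onM D f g : open D ->
  smooth_on D f -> smooth_on D g -> smooth_on D (f * g).
Proof. by move=> oD sf sg k; exact: differentiable_uptoM. Qed.

End SmoothOnTheory.

Record chart (R : realType) (n : nat) (M : topologicalType) := Chart {
  chart_dom : set M;
  chart_map :> M -> 'rV[R]_n;
  chart_inv : 'rV[R]_n -> M;
  chart_dom_open : open chart_dom;
  chart_img_open : open (chart_map @` chart_dom);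
  chart_mapK : forall p, chart_dom p -> chart_inv (chart_map p) = p;
  chart_map_continuous :
    forall p, chart_dom p -> {for p, continuous chart_map};
  chart_inv_continuous :
    forall p, chart_dom p -> {for chart_map p, continuous chart_inv}
}.

HB.mixin Record isSmoothManifold (R : realType) (n : nat) M
    of Topological M := {
  manifold_hausdorff : hausdorff_space M;
  manifold_second_countable : @second_countable M;
  atlas : set (chart R n M);
  atlas_cover : forall p : M, exists2 c, atlas c & chart_dom c p;
  atlas_compatible : forall c d, atlas c -> atlas d ->
    smooth_on (c @` (chart_dom c `&` chart_dom d)) (d \o chart_inv c)
}.

#[short(type="smoothManifoldType")]
HB.structure Definition SmoothManifold (R : realType) (n : nat) :=
  {M of Topological M & isSmoothManifold R n M}.

Section SmoothMaps.
Context {R : realType} {m n p : nat}.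

Definition smooth_fun (M : smoothManifoldType R m) (f : M -> R) : Prop :=
  forall c, atlas c -> smooth_on (c @` chart_dom c) (f \o chart_inv c).

Definition smooth_map (M : smoothManifoldType R m)
    (N : smoothManifoldType R n) (f : M -> N) : Prop :=
  continuous f /\
  forall c d, atlas c -> atlas d ->
    smooth_on (c @` (chart_dom c `&` f @^-1` chart_dom d))
              (d \o f \o chart_inv c).

(* Smoothness of (x, y) |-> f x y on the product manifold M x N, with respect
   to the product charts *)
Definition smooth_map2 (M : smoothManifoldType R m)
    (N : smoothManifoldType R n) (P : smoothManifoldType R p)
    (f : M -> N -> P) : Prop :=
  continuous (fun z : M * N => f z.1 z.2) /\
  forall c d e, atlas c -> atlas d -> atlas e ->
    smooth_on
      [set w : 'rV[R]_m * 'rV[R]_n | exists x y,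
         [/\ chart_dom c x, chart_dom d y, chart_dom e (f x y)
           & w = (c x, d y)]]
      (fun w => e (f (chart_inv c w.1) (chart_inv d w.2))).

Definition immersion (M : smoothManifoldType R m)
    (N : smoothManifoldType R n) (f : M -> N) : Prop :=
  smooth_map f /\
  forall c d x, atlas c -> atlas d -> chart_dom c x -> chart_dom d (f x) ->
    injective ('d (d \o f \o chart_inv c) (c x)).

End SmoothMaps.

Section SmoothFunctions.
Context {R : realType} {n : nat} (M : smoothManifoldType R n).

Definition smooth_pred : {pred M -> R} := fun f => `[< smooth_fun f >].

Record smoothfn := SmoothFn {
  smoothfn_val :> M -> R;
  smoothfn_subproof : smoothfn_val \in smooth_pred
}.

HB.instance Definition _ := [isSub for smoothfn_val].
HB.instance Definition _ := [Choice of smoothfn by <:].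

Lemma smooth_funD (f g : M -> R) :
  smooth_fun f -> smooth_fun g -> smooth_fun (f + g).
Proof.
move=> sf sg c ac.
exact: (smooth_onD (@chart_img_open _ _ _ c) (sf c ac) (sg c ac)).
Qed.

Lemma smooth_funM (f g : M -> R) :
  smooth_fun f -> smooth_fun g -> smooth_fun (f * g).
Proof.
move=> sf sg c ac.
exact: (smooth_onM (@chart_img_open _ _ _ c) (sf c ac) (sg c ac)).
Qed.

Lemma smooth_fun_cst (a : R) : @smooth_fun R n M (cst a).
Proof. by move=> c ac; exact: smooth_on_cst. Qed.

Lemma smooth_submod_closed : submod_closed smooth_pred.
Proof.
split; first by apply/asboolP; exact: (smooth_fun_cst 0).
move=> a f g /asboolP sf /asboolP sg; apply/asboolP.
exact: smooth_funD (smooth_funM (smooth_fun_cst a) sf) sg.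
Qed.

HB.instance Definition _ :=
  GRing.isSubmodClosed.Build R (M -> R) smooth_pred smooth_submod_closed.
HB.instance Definition _ := [SubChoice_isSubLmodule of smoothfn by <:].

Lemma smoothfnP (f : smoothfn) : smooth_fun (f : M -> R).
Proof. by apply/asboolP; case: f. Qed.

Fact smoothfn_mul_subproof (f g : smoothfn) :
  ((f : M -> R) * (g : M -> R)) \in smooth_pred.
Proof. by apply/asboolP/smooth_funM; exact: smoothfnP. Qed.

Definition smoothfn_mul (f g : smoothfn) : smoothfn :=
  SmoothFn (smoothfn_mul_subproof f g).

Lemma smoothfnE (f g : smoothfn) : (forall x, f x = g x) -> f = g.
Proof. by move=> fg; apply/val_inj/funext. Qed.

End SmoothFunctions.

HB.mixin Record isLieGroup (R : realType) (n : nat) G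
    of SmoothManifold R n G & Group G := {
  lie_group_mul_smooth : smooth_map2 (fun x y : G => (x * y)%g);
  lie_group_inv_smooth : smooth_map (fun x : G => (x^-1)%g)
}.

#[short(type="lieGroupType")]
HB.structure Definition LieGroup (R : realType) (n : nat) :=
  {G of SmoothManifold R n G & Group G & isLieGroup R n G}.

Section LeftInvariantFields.
Context {R : realType} {n : nat} (G : lieGroupType R n).
Local Notation Cinf := (smoothfn G).

(* Vector fields are the derivations of the algebra of smooth functions. The
   last clause says that D commutes with left translations: h is the smooth
   function f \o (g * _). *)
Definition left_invariant_field (D : Cinf -> Cinf) : Prop :=
  [/\ forall (a : R) f g, D (a *: f + g) = a *: D f + D g,
      forall f g, D (smoothfn_mul f g) =
                  smoothfn_mul (D f) g + smoothfn_mul f (D g)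
    & forall (g : G) (f h : Cinf), (forall x, h x = f (g * x)%g) ->
        forall x, D h x = D f (g * x)%g].

Definition left_invariant_pred : {pred Cinf -> Cinf} :=
  fun D => `[< left_invariant_field D >].

Record lieAlg := LieAlg {
  lieAlg_val :> Cinf -> Cinf;
  lieAlg_subproof : lieAlg_val \in left_invariant_pred
}.

HB.instance Definition _ := [isSub for lieAlg_val].
HB.instance Definition _ := [Choice of lieAlg by <:].

Lemma smoothfnDE (f g : Cinf) x : (f + g) x = f x + g x.
Proof. by []. Qed.

Lemma smoothfnZE (a : R) (f : Cinf) x : (a *: f) x = a * f x.
Proof. by []. Qed.

Lemma smoothfnNE (f : Cinf) x : (- f) x = - f x.
Proof. by []. Qed.

Lemma smoothfnME (f g : Cinf) x : smoothfn_mul f g x = f x * g x.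
Proof. by []. Qed.

Let smoothfn_pointwise := (smoothfnDE, smoothfnZE, smoothfnNE, smoothfnME).

Lemma left_invariant_submod_closed : submod_closed left_invariant_pred.
Proof.
split.
  apply/asboolP; split=> [a f g|f g|g f h _ x //].
    by rewrite -[RHS]/(a *: 0 + 0) scaler0 addr0.
  by apply: smoothfnE => x; rewrite !smoothfn_pointwise mul0r mulr0 addr0.
move=> a D E /asboolP[Dl DM Di] /asboolP[El EM Ei]; apply/asboolP.
have appE f : (a *: D + E) f = a *: D f + E f by [].
split=> [b f g|f g|g f h fh x]; rewrite ?appE.
- rewrite Dl El !scalerDr !scalerA mulrC.
  by rewrite (AC (2*2) ((1*3)*(2*4))).
- rewrite DM EM; apply: smoothfnE => x; rewrite !smoothfn_pointwise.
  by rewrite mulrDl !mulrDr mulrA [f x * (a * _)]mulrCA (AC (2*2) ((1*3)*(2*4))).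
- by rewrite !smoothfn_pointwise (Di g f)// (Ei g f).
Qed.

HB.instance Definition _ := GRing.isSubmodClosed.Build R (Cinf -> Cinf)
  left_invariant_pred left_invariant_submod_closed.
HB.instance Definition _ := [SubChoice_isSubLmodule of lieAlg by <:].

Lemma lieAlgP (X : lieAlg) : left_invariant_field X.
Proof. by apply/asboolP; case: X. Qed.

Lemma lieAlgB (X : lieAlg) f g : X (f - g) = X f - X g.
Proof.
have [Xl _ _] := lieAlgP X.
by rewrite -scaleN1r addrC Xl scaleN1r addrC.
Qed.

Lemma lieAlgD (X : lieAlg) f g : X (f + g) = X f + X g.
Proof. by have [Xl _ _] := lieAlgP X; have := Xl 1 f g; rewrite !scale1r. Qed.

Fact field_bracket_subproof (X Y : lieAlg) :
  (fun f => X (Y f) - Y (X f)) \in left_invariant_pred.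
Proof.
have [Xl XM Xi] := lieAlgP X; have [Yl YM Yi] := lieAlgP Y.
apply/asboolP; split=> [a f g|f g|g f h fh x].
- rewrite Xl Yl Xl Yl scalerBr opprD.
  by rewrite (AC (2*2) ((1*3)*(2*4))).
- rewrite YM XM !lieAlgD !XM !YM; apply: smoothfnE => x.
  by rewrite !smoothfn_pointwise; ring.
- rewrite !smoothfnDE !smoothfnNE (Xi g (Y f) (Y h)) ?(Yi g (X f) (X h)) //.
    by move=> y; exact: Xi.
  by move=> y; exact: Yi.
Qed.

Definition field_bracket (X Y : lieAlg) : lieAlg :=
  LieAlg (field_bracket_subproof X Y).

Lemma lieAlgE (X Y : lieAlg) : (forall f x, X f x = Y f x) -> X = Y.
Proof. by move=> XY; apply/val_inj/funext => f; apply: smoothfnE => x. Qed.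

Lemma field_bracketE (X Y : lieAlg) f x :
  field_bracket X Y f x = X (Y f) x - Y (X f) x.
Proof. by []. Qed.

Lemma lieAlgDE (X Y : lieAlg) f x : (X + Y) f x = X f x + Y f x.
Proof. by []. Qed.

Lemma lieAlgZE (a : R) (X : lieAlg) f x : (a *: X) f x = a * X f x.
Proof. by []. Qed.

Fact field_bracket_linearl (Z : lieAlg) (a : R) (X Y : lieAlg) :
  field_bracket (a *: X + Y) Z =
  a *: field_bracket X Z + field_bracket Y Z.
Proof.
have [Zl _ _] := lieAlgP Z.
apply: lieAlgE => f x; rewrite lieAlgDE lieAlgZE !field_bracketE.
have -> : (a *: X + Y) f = a *: X f + Y f by [].
by rewrite Zl lieAlgDE lieAlgZE smoothfnDE smoothfnZE; ring.
Qed.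

Fact field_bracket_skew (X Y : lieAlg) :
  field_bracket X Y = - field_bracket Y X.
Proof.
apply: lieAlgE => f x; rewrite -scaleN1r lieAlgZE !field_bracketE.
by rewrite mulN1r opprB.
Qed.

Fact field_bracket_linearr (Z : lieAlg) (a : R) (X Y : lieAlg) :
  field_bracket Z (a *: X + Y) =
  a *: field_bracket Z X + field_bracket Z Y.
Proof.
by rewrite field_bracket_skew field_bracket_linearl opprD -scalerN
  -!(field_bracket_skew Z).
Qed.

Fact field_bracket_alt (X : lieAlg) : field_bracket X X = 0.
Proof. by apply: lieAlgE => f x; rewrite field_bracketE subrr. Qed.

Fact field_bracket_jacobi (X Y Z : lieAlg) :
  field_bracket X (field_bracket Y Z) + field_bracket Y (field_bracket Z X) +
  field_bracket Z (field_bracket X Y) = 0.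
Proof.
have bE (U V : lieAlg) f : field_bracket U V f = U (V f) - V (U f) by [].
apply: lieAlgE => f x; rewrite !lieAlgDE !field_bracketE !bE !lieAlgB.
by rewrite !smoothfnDE !smoothfnNE -[RHS]/(0 : R); ring.
Qed.

HB.instance Definition _ := isLieAlgebra.Build R lieAlg
  field_bracket_linearl field_bracket_linearr field_bracket_alt
  field_bracket_jacobi.

End LeftInvariantFields.

Section LieSubgroups.
Context {R : realType}.

(* X on G and Y on H are F-related: X (f \o F) = (Y f) \o F for every smooth
   function f on H, h being the smooth function f \o F. *)
Definition related {m n : nat} (G : lieGroupType R m) (H : lieGroupType R n)
    (F : G -> H) (X : lieAlg G) (Y : lieAlg H) : Prop :=
  forall (f : smoothfn H) (h : smoothfn G), (forall x, h x = f (F x)) ->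
    forall x, X h x = Y f (F x).

(* The homomorphism dF of Lie algebras induced by a homomorphism F of Lie
   groups: dF X is the unique left-invariant field that is F-related to X. *)
Definition lie_differential {m n : nat} (G : lieGroupType R m)
    (H : lieGroupType R n) (F : G -> H) (X : lieAlg G) : lieAlg H :=
  xget 0 [set Y | related F X Y].

Definition Ad {n : nat} (G : lieGroupType R n) (g : G) : lieAlg G -> lieAlg G :=
  lie_differential (fun x : G => (g * x * g^-1)%g).

(* A Lie subgroup need not be closed, nor carry the induced topology. *)
Record lieSubgroup {n : nat} (U : lieGroupType R n) := LieSubgroup {
  lsub_dim : nat;
  lsub_group :> lieGroupType R lsub_dim;
  lsub_incl : lsub_group -> U;
  lsub_inclM : forall x y, lsub_incl (x * y)%g = (lsub_incl x * lsub_incl y)%g;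
  lsub_incl_inj : injective lsub_incl;
  lsub_incl_immersion : immersion lsub_incl
}.

Section LieSubgroup.
Context {n : nat} {U : lieGroupType R n}.
Implicit Types L T : lieSubgroup U.

Definition lsub_set L : set U := range (@lsub_incl _ _ L).

Definition proper_lieSubgroup L : Prop := lsub_set L <> setT.

(* The Lie algebra of L, as a subalgebra of the Lie algebra of U *)
Definition lsub_lieAlg L : set (lieAlg U) :=
  range (lie_differential (@lsub_incl _ _ L)).

Definition torus T : Prop :=
  [/\ compact [set: T], connected [set: T]
    & forall x y : T, (x * y = y * x)%g].

Definition maximal_torus T : Prop :=
  torus T /\
  forall T', torus T' -> lsub_set T `<=` lsub_set T' ->
    lsub_set T' = lsub_set T.

End LieSubgroup.
End LieSubgroups.

Section AdjointOrbits.
Context {R : realType} {n : nat} {U : lieGroupType R n}.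
Implicit Types (x xi eta : lieAlg U) (L : lieSubgroup U).

Definition fundamental_field (X x : lieAlg U) : lieAlg U := [lie X, x].

Definition Ad_orbit L x : set (lieAlg U) :=
  [set Ad u x | u in lsub_set L].

(* The tangent space at x of an L-orbit through x is spanned by the fundamental
   fields of the elements of the Lie algebra of L. *)
Definition Ad_orbit_tangent L x : set (lieAlg U) :=
  [set fundamental_field X x | X in lsub_lieAlg L].

(* The Kirillov--Kostant--Souriau form at the point x of its adjoint orbit.
   The value <x, [X, Y]> only depends on the tangent vectors xi and eta of the
   orbit, which are the values at x of the fundamental fields of X and Y. *)
Definition KKS_form x xi eta : R :=
  xget 0 [set r | exists X Y : lieAlg U,
    [/\ xi = fundamental_field X x, eta = fundamental_field Y x
      & r = killing x [lie X, Y]]].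

Definition isotropic_orbit L x0 : Prop :=
  forall x, Ad_orbit L x0 x ->
  forall xi eta, Ad_orbit_tangent L x xi -> Ad_orbit_tangent L x eta ->
    KKS_form x xi eta = 0.

End AdjointOrbits.

(* Main.v *)
From HB Require Import structures.
Require Import Defs.
From mathcomp Require Import all_boot all_order all_algebra.
From mathcomp Require Import complex.
From mathcomp Require Import all_classical all_reals all_analysis.

Set Implicit Arguments.
Unset Strict Implicit.
Unset Printing Implicit Defensive.

Import Order.TTheory GRing.Theory Num.Theory.
Import numFieldNormedType.Exports.

Local Open Scope classical_set_scope.
Local Open Scope ring_scope.

(** Write $<x, y>$ for the Killing form of the Lie algebra u of U, and l for
the Lie algebra of L.  The argument has two ingredients, the invariance of the
Killing form and its behaviour along the orbit.

The identity $<[x, X], Y> = <x, [X, Y]>$ ([killing_lie]) gives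
$<x, [X, Y]> = - <[X, x], Y>$, so this number depends on X only through [X, x]
and, by antisymmetry, on Y only through [Y, x].  The form at x is therefore
well defined, with value $<x, [X, Y]>$ on the fundamental vectors of X and Y
([KKS_formE]).  At x = iH_0 it vanishes on the tangent space of the L-orbit
exactly when iH_0 is orthogonal to all brackets of elements of l, that is, to
their span l'.

It remains to move from the origin to an arbitrary point Ad(u)(iH_0) of the
orbit, with u in L.  The map Ad(u) is an automorphism of u, hence an isometry
for the Killing form ([killing_Ad]), and it preserves l ([lsub_lieAlg_Ad]).  So
$<Ad(u)(iH_0), [X, Y]> = <iH_0, [Ad(u^-1)X, Ad(u^-1)Y]>$, and the bracket on the
right is again in l'.

The Killing form is handled through adjoint matrices in a basis of u.  If there
were no finite basis, the trace would be 0 by convention and every identity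
above would hold trivially.

Left-invariant fields are derivations of the algebra of smooth functions, so
Ad(u) has to be computed from its action on functions: Ad(u)X sends f to
X(f o c_u) o c_u^-1, where c_u is conjugation by u ([AdE]).  That this makes
sense, and that it is the only field c_u-related to X, requires f o F to be
smooth whenever f and F are.  This rests on a chain rule at every order of
differentiability ([differentiable_upto_comp]). *)

(** * Traces of endomorphisms and the Killing form *)

Section Trace.
Context {F : fieldType}.

(** The set of candidate values from which [endo_trace] is chosen. *)
Definition trace_set {V : lmodType F} (f : V -> V) : set F :=
  [set t | exists n (b : 'I_n -> V) (A : 'M[F]_n),
    [/\ is_basis b, forall j, f (b j) = \sum_i A i j *: b i & t = \tr A]].

(** An isomorphism carries a basis to a basis and keeps the matrix, so a trace
of f is a trace of any endomorphism conjugate to f.  Comparing sets of values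
also covers the case without a basis, where they are empty. *)
Lemma trace_set_conj {V W : lmodType F} (phi : {linear V -> W}) (psi : W -> V) f g :
  cancel phi psi -> cancel psi phi -> (forall x, g (phi x) = phi (f x)) ->
  trace_set f `<=` trace_set g.
Proof.
move=> phiK psiK gphi t [n [b [A [bb fb ->]]]].
exists n, (phi \o b), A; split=> // [w|j]; last first.
  by rewrite /= gphi fb linear_sum; apply: eq_bigr => i _; rewrite linearZ.
have phisum (c : 'rV_n) : \sum_i c 0 i *: phi (b i) = phi (\sum_i c 0 i *: b i).
  by rewrite linear_sum; apply: eq_bigr => i _; rewrite linearZ.
have [c [wc uc]] := bb (psi w); exists c; split=> [|c'].
  by rewrite /= phisum -wc psiK.
by rewrite /= phisum => wc'; apply: uc; rewrite wc' phiK.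
Qed.

Lemma basis_free {V : lmodType F} n (b : 'I_n -> V) (c d : 'I_n -> F) :
  is_basis b -> \sum_i c i *: b i = \sum_i d i *: b i -> c =1 d.
Proof.
move=> bb cd i; have [e [_ ue]] := bb (\sum_i c i *: b i).
have ec : e = \row_j c j by apply: ue; apply: eq_bigr => j _; rewrite mxE.
have ed : e = \row_j d j by apply: ue; rewrite cd; apply: eq_bigr => j _; rewrite mxE.
by have /(congr1 (fun r : 'rV_n => r 0 i)) := etrans (esym ec) ed; rewrite !mxE.
Qed.

Lemma basis_free_mx {V : lmodType F} n (b : 'I_n -> V) m (A B : 'M[F]_(n, m)) :
  is_basis b -> (forall k, \sum_i A i k *: b i = \sum_i B i k *: b i) -> A = B.
Proof.
by move=> bb AB; apply/matrixP => i k; exact: (basis_free bb (AB k)).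
Qed.

Lemma basis_coord {V : lmodType F} n (b : 'I_n -> V) m (v : 'I_m -> V) :
  is_basis b -> exists P : 'M[F]_(n, m), forall j, v j = \sum_i P i j *: b i.
Proof.
move=> bb; have [c cE] : {c : 'I_m -> 'rV[F]_n & forall j, v j = \sum_i c j 0 i *: b i}.
  apply: (@choice 'I_m 'rV[F]_n (fun j c => v j = \sum_i c 0 i *: b i)) => j.
  by have [c [cv _]] := bb (v j); exists c.
by exists (\matrix_(i, j) c j 0 i) => j; rewrite cE; apply: eq_bigr => i _; rewrite mxE.
Qed.

(** Composition of changes of coordinates: if A holds the coordinates of the
family w in the family b, then A *m B holds those of the combinations of w with
coefficients B. *)
Lemma sum_mulmx {V : lmodType F} n m p (b : 'I_n -> V) (w : 'I_m -> V)
    (A : 'M[F]_(n, m)) (B : 'M[F]_(m, p)) k :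
  (forall j, w j = \sum_i A i j *: b i) ->
  \sum_j B j k *: w j = \sum_i (A *m B) i k *: b i.
Proof.
move=> wE; under eq_bigr do rewrite wE scaler_sumr.
rewrite exchange_big; apply: eq_bigr => i _; rewrite mxE scaler_suml.
by apply: eq_bigr => j _; rewrite scalerA mulrC.
Qed.

(** Two bases b and b' are exchanged by matrices P and Q with QP = 1 and PQ = 1,
and tr(QAP) = tr(APQ) = tr A.  P and Q are a priori rectangular,
which the cyclicity of the trace allows. *)
Lemma endo_traceE {V : lmodType F} (f : {linear V -> V}) n (b : 'I_n -> V) (A : 'M[F]_n) :
  is_basis b -> (forall j, f (b j) = \sum_i A i j *: b i) ->
  endo_trace f = \tr A.
Proof.
move=> bb fb; apply: xget_unique; first by exists n, b, A.
move=> _ [m [b' [A' [bb' fb' ->]]]].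
have [P PE] := basis_coord b' bb; have [Q QE] := basis_coord b bb'.
have PQ : P *m Q = 1%:M.
  apply: (basis_free_mx bb) => k.
  rewrite -(sum_mulmx _ _ PE) -QE (bigD1 k)//= mxE eqxx scale1r big1 ?addr0//.
  by move=> j jk; rewrite mxE (negbTE jk) scale0r.
have AP : A *m P = P *m A'.
  apply: (basis_free_mx bb) => k.
  rewrite -(sum_mulmx _ _ PE) -(sum_mulmx _ _ fb) -fb' PE linear_sum.
  by apply: eq_bigr => j _; rewrite linearZ.
have QP : Q *m P = 1%:M.
  apply: (basis_free_mx bb') => k.
  rewrite -(sum_mulmx _ _ QE) -PE (bigD1 k)//= mxE eqxx scale1r big1 ?addr0//.
  by move=> j jk; rewrite mxE (negbTE jk) scale0r.
by rewrite -[A']mul1mx -QP -mulmxA -AP mxtrace_mulC -mulmxA PQ mulmx1.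
Qed.

End Trace.

Section Killing.
Context {F : fieldType} {V : lieAlgType F}.
Implicit Types x y z : V.

(** This reduces the properties of the Killing form to computations with traces
of matrices; M is the adjoint representation in a basis, and the first case is
that of a Lie algebra with no finite basis. *)
Lemma killing_matrix :
  (forall x y, killing x y = 0) \/
  exists n (M : V -> 'M[F]_n),
    [/\ forall a x y, M (a *: x + y) = a *: M x + M y,
        forall x y, M [lie x, y] = M x *m M y - M y *m M x
      & forall x y, killing x y = \tr (M x *m M y)].
Proof.
have [[n [b bb]]|nob] := pselect (exists n (b : 'I_n -> V), is_basis b); last first.
  left=> x y; apply: xgetPN => t [n [b [A [bb _ _]]]]; apply: nob.
  by exists n, b.
right; exists n.
have [M ME] : {M : V -> 'M[F]_n & forall x j, [lie x, b j] = \sum_i M x i j *: b i}.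
  apply: (@choice V 'M[F]_n (fun x A => forall j, [lie x, b j] = \sum_i A i j *: b i)).
  by move=> x; exact: basis_coord bb.
have lieM x (B : 'M[F]_n) j : [lie x, \sum_i B i j *: b i] = \sum_i (M x *m B) i j *: b i.
  pose ad := GRing.isLinear.Build F V V *:%R (lie x) (fun a u v => lie_linearr x a u v).
  pose L : {linear V -> V} := HB.pack (lie x) ad.
  rewrite -[(lie x)]/(L : V -> V) linear_sum -(sum_mulmx _ _ (ME x)).
  by apply: eq_bigr => i _; rewrite linearZ.
exists M; split=> [a x y|x y|x y].
- apply: (basis_free_mx bb) => j.
  rewrite -ME lie_linearl !ME scaler_sumr -big_split; apply: eq_bigr => k _.
  by rewrite !mxE scalerDl scalerA.
- apply: (basis_free_mx bb) => j.
  (* the Jacobi identity says that ad [x, y] is the commutator of ad x and ad y *)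
  rewrite -ME; have /eqP := lie_jacobi x y (b j).
  rewrite [X in _ + X]lieC subr_eq0 => /eqP <-.
  rewrite (lieC (b j) x) lieNr !ME !lieM -sumrB.
  by apply: eq_bigr => k _; rewrite !mxE scalerBl.
- pose ad2 := GRing.isLinear.Build F V V *:%R (fun z => [lie x, [lie y, z]])
     (fun a u v => etrans (congr1 (lie x) (lie_linearr y a u v)) (lie_linearr x _ _ _)).
  pose L : {linear V -> V} := HB.pack (fun z => [lie x, [lie y, z]]) ad2.
  by rewrite /killing -[RHS](@endo_traceE _ _ L _ b) // => j; rewrite /= ME lieM.
Qed.

Lemma killing_scalar x : scalar (killing x).
Proof.
move=> a y z.
have [k0|[n [M [Ml _ kM]]]] := killing_matrix; first by rewrite !k0 mulr0 addr0.
by rewrite !kM Ml mulmxDr -scalemxAr mxtraceD mxtraceZ.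
Qed.

HB.instance Definition _ x :=
  GRing.isLinear.Build F V F *%R (killing x) (killing_scalar x).

Lemma killingC x y : killing x y = killing y x.
Proof.
have [k0|[n [M [_ _ kM]]]] := killing_matrix; first by rewrite !k0.
by rewrite !kM mxtrace_mulC.
Qed.

(** With matrices, both sides equal tr(xyz) up to tr(yxz) = tr(xzy). *)
Lemma killing_lie x y z : killing [lie x, y] z = killing x [lie y, z].
Proof.
have [k0|[n [M [_ Mlie kM]]]] := killing_matrix; first by rewrite !k0.
rewrite !kM !Mlie mulmxBl mulmxBr !linearB/= !mulmxA.
by congr (_ - _); rewrite [RHS]mxtrace_mulC mulmxA.
Qed.

(** An automorphism conjugates ad x ad y into ad (phi x) ad (phi y). *)
Lemma killing_automorphism (phi : {linear V -> V}) (psi : V -> V) x y :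
  cancel phi psi -> cancel psi phi ->
  (forall x y, phi [lie x, y] = [lie phi x, phi y]) ->
  killing (phi x) (phi y) = killing x y.
Proof.
move=> phiK psiK phi_lie; rewrite /killing /endo_trace; congr (xget 0 _).
have psi_lin : linear psi.
  by move=> a u v; apply: (can_inj phiK); rewrite linearP !psiK.
pose Psi : {linear V -> V} := HB.pack psi (GRing.isLinear.Build F V V *:%R psi psi_lin).
pose ad2 x y := fun z : V => [lie x, [lie y, z]].
rewrite -[LHS]/(trace_set (ad2 (phi x) (phi y))) -[RHS]/(trace_set (ad2 x y)).
apply/seteqP; split.
  apply: (trace_set_conj (phi := Psi) psiK phiK) => z /=.
  by apply: (can_inj phiK); rewrite !phi_lie !psiK.
by apply: (trace_set_conj phiK psiK) => z; rewrite /ad2 !phi_lie.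
Qed.

End Killing.

(** * The chain rule for smooth maps *)

Section Smooth.
Context {R : realType}.

(** Although its recursion runs over a set, [differentiable_upto] is a condition
at each point separately; this is what lets smoothness be checked chart by
chart. *)
Lemma differentiable_upto_pointwise {V W : normedModType R} k (D : set V) (f : V -> W) :
  differentiable_upto k D f <-> forall x, D x -> differentiable_upto k [set x] f.
Proof.
elim: k f => [|k IH] f /=.
  by split=> [df x Dx _ ->|df x Dx]; [exact: df|exact: (df x Dx x)].
split=> [[df Df] x Dx|df].
  split=> [_ ->|v]; first exact: df.
  by have /IH := Df v; exact.
split=> [x Dx|v]; first by have [dfx _] := df x Dx; exact: dfx.
by apply/IH => x Dx; have [_] := df x Dx; exact.
Qed.

(** The analogue of [differentiable_uptoW] for vector-valued maps. *)
Lemma differentiable_uptoS {V W : normedModType R} k (D : set V) (f : V -> W) :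
  differentiable_upto k.+1 D f -> differentiable_upto k D f.
Proof.
elim: k f => [|k IH] f /= [df Df].
  by move=> x /df; exact: differentiable_continuous.
by split=> // v; apply: IH; exact: Df.
Qed.

Lemma derive_coord {V : normedModType R} n (g : V -> 'rV[R]_n) x v j :
  differentiable g x -> 'D_v (fun y => g y 0 j) x = 'D_v g x 0 j.
Proof. by move=> dg; rewrite derive_mx ?mxE//; exact: diff_derivable. Qed.

Lemma differentiable_upto_coord {V : normedModType R} n k D (g : V -> 'rV[R]_n) j :
  open D -> differentiable_upto k D g ->
  differentiable_upto k D (fun x => g x 0 j).
Proof.
move=> oD; elim: k g => [|k IH] g /=.
  move=> cg x Dx; apply: (@continuous_comp _ _ _ g (fun N : 'rV[R]_n => N 0 j)).
    exact: cg.
  exact: coord_continuous.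
move=> [dg Dg]; split=> [x Dx|v].
  apply: (@differentiable_comp _ _ _ _ g (fun N : 'rV[R]_n => N 0 j)); first exact: dg.
  exact: differentiable_coord.
apply: (differentiable_upto_ext oD _ (IH _ (Dg v))) => x Dx.
by rewrite derive_coord//; exact: dg.
Qed.

Lemma differentiable_upto_sum {V : normedModType R} k D n (f : 'I_n -> V -> R) :
  open D -> (forall j, differentiable_upto k D (f j)) ->
  differentiable_upto k D (\sum_j f j).
Proof.
move=> oD df; elim/big_ind: _ => //; first exact: (differentiable_upto_cst _ _ 0).
by move=> *; exact: differentiable_uptoD.
Qed.

(** The chain rule in coordinates, which expresses a derivative of f o g by
products of real functions of one order of differentiability less. *)
Lemma derive_comp_coord {V : normedModType R} n (g : V -> 'rV[R]_n)
    (f : 'rV[R]_n -> R) x v :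
  differentiable g x -> differentiable f (g x) ->
  'D_v (f \o g) x = \sum_j 'D_v g x 0 j * 'D_(delta_mx 0 j) f (g x).
Proof.
move=> dg df; rewrite deriveE; last exact: differentiable_comp dg df.
rewrite diff_comp// [LHS]/= -(deriveE v dg) [in LHS](row_sum_delta ('D_v g x)) linear_sum.
by apply: eq_bigr => j _; rewrite linearZ (deriveE v dg) (deriveE _ df).
Qed.

(** By induction on the order: by [derive_comp_coord] the derivatives of f o g
are sums of products of coordinates of derivatives of g with partial
derivatives of f composed with g, and the latter fall under the induction
hypothesis. *)
Lemma differentiable_upto_comp {V : normedModType R} n k (D : set V)
    (E : set 'rV[R]_n) (g : V -> 'rV[R]_n) (f : 'rV[R]_n -> R) :
  open D -> (forall x, D x -> E (g x)) ->
  differentiable_upto k D g -> differentiable_upto k E f ->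
  differentiable_upto k D (f \o g).
Proof.
move=> oD DE; elim: k f => [|k IH] f.
  by move=> /= cg cf x Dx; apply: continuous_comp; [exact: cg|exact/cf/DE].
move=> dgS; have dg := differentiable_uptoS dgS; case: dgS => dg1 Dg [df1 Df].
split=> [x Dx|v]; first by apply: differentiable_comp; [exact: dg1|exact/df1/DE].
have dsum : differentiable_upto k D
    (\sum_j (fun x => 'D_v g x 0 j) * ('D_(delta_mx 0 j) f \o g)).
  apply: differentiable_upto_sum => // j; apply: differentiable_uptoM => //.
    exact: (differentiable_upto_coord j oD (Dg v)).
  exact: (IH _ dg (Df _)).
apply: (differentiable_upto_ext oD _ dsum) => x Dx.
rewrite derive_comp_coord ?fct_sumE//; first exact: dg1.
exact/df1/DE.
Qed.

(** Freezing the first variable: the derivative of f(a, -) along v is that of f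
along (0, v), literally the same limit. *)
Lemma differentiable_upto_pairl {V1 V2 W : normedModType R} k (E : set (V1 * V2))
    (f : V1 * V2 -> W) (a : V1) :
  differentiable_upto k E f ->
  differentiable_upto k [set y | E (a, y)] (fun y => f (a, y)).
Proof.
elim: k f => [|k IH] f /=.
  move=> cf y Ey; apply: (@continuous_comp _ _ _ (pair a) f); last exact: cf.
  by apply: cvg_pair => //=; exact: cvg_cst.
move=> [df Df]; split=> [y Ey|v].
  apply: (@differentiable_comp _ _ _ _ (pair a) f); last exact: df.
  by apply: differentiable_pair => //=; exact: differentiable_cst.
have -> : (fun x => 'D_v (fun y => f (a, y)) x) = (fun y => 'D_(0, v) f (a, y)).
  apply/funext => y; rewrite /derive; set q := fun _ : R => _; set q' := fun _ : R => _.
  suff -> : q = q' by []; apply/funext => h; rewrite /q /q' /=.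
  have -> : h *: (0, v) + (a, y) = (h *: 0 + a, h *: v + y) :> V1 * V2 by [].
  by rewrite scaler0 add0r.
exact: (IH _ (Df (0, v))).
Qed.

Lemma differentiable_upto_pairr {V1 V2 W : normedModType R} k (E : set (V1 * V2))
    (f : V1 * V2 -> W) (b : V2) :
  differentiable_upto k E f ->
  differentiable_upto k [set x | E (x, b)] (fun x => f (x, b)).
Proof.
elim: k f => [|k IH] f /=.
  move=> cf x Ex; apply: (@continuous_comp _ _ _ (fun x => (x, b)) f); last exact: cf.
  by apply: cvg_pair => //=; exact: cvg_cst.
move=> [df Df]; split=> [x Ex|v].
  apply: (@differentiable_comp _ _ _ _ (fun x => (x, b)) f); last exact: df.
  by apply: differentiable_pair => //=; exact: differentiable_cst.
have -> : (fun x => 'D_v (fun x => f (x, b)) x) = (fun x => 'D_(v, 0) f (x, b)).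
  apply/funext => x; rewrite /derive; set q := fun _ : R => _; set q' := fun _ : R => _.
  suff -> : q = q' by []; apply/funext => h; rewrite /q /q' /=.
  have -> : h *: (v, 0) + (x, b) = (h *: v + x, h *: 0 + b) :> V1 * V2 by [].
  by rewrite scaler0 add0r.
exact: (IH _ (Df (v, 0))).
Qed.

End Smooth.

Section Pullback.
Context {R : realType} {m n : nat}.

Lemma chart_preimage_open (M : smoothManifoldType R m) (c : chart R m M) (A : set M) :
  open A -> open (c @` (chart_dom c `&` A)).
Proof.
move=> oA; rewrite openE => _ [p [cp Ap] <-].
have nA : \forall w \near c p, A (chart_inv c w).
  apply: (chart_inv_continuous cp); rewrite chart_mapK //.
  exact: open_nbhs_nbhs.
have nD : \forall w \near c p, (c @` chart_dom c) w.
  by apply: open_nbhs_nbhs; split; [exact: chart_img_open|exists p].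
near=> w; have [q cq qw] : (c @` chart_dom c) w by near: w.
exists q => //; split=> //; have : A (chart_inv c w) by near: w.
by rewrite -qw chart_mapK.
Unshelve. all: by end_near. Qed.

(** Near a point p the function reads (f o d^-1) o (d o F o c^-1) in a chart c at
p and a chart d at F p, so that the Euclidean chain rule applies. *)
Lemma smooth_fun_comp (M : smoothManifoldType R m) (N : smoothManifoldType R n)
    (F : M -> N) (f : N -> R) :
  smooth_map F -> smooth_fun f -> smooth_fun (f \o F).
Proof.
move=> [cF sF] sf c ac k; apply/differentiable_upto_pointwise => _ [p cp <-].
have [d ad dFp] := atlas_cover (F p).
pose D := c @` (chart_dom c `&` F @^-1` chart_dom d).
have oD : open D.
  by apply: chart_preimage_open; apply: open_comp;
    [move=> *; exact: cF|exact: chart_dom_open].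
have dcomp : differentiable_upto k D ((f \o chart_inv d) \o (d \o F \o chart_inv c)).
  apply: (@differentiable_upto_comp _ _ _ _ _ (d @` chart_dom d)) => //.
  - by move=> _ [q [cq dq] <-]; exists (F q) => //=; rewrite chart_mapK.
  - exact: sF.
  - exact: sf.
have : differentiable_upto k D (f \o F \o chart_inv c).
  apply: (differentiable_upto_ext oD _ dcomp) => _ [q [cq dq] <-] /=.
  by rewrite (chart_mapK cq) chart_mapK.
by move=> /differentiable_upto_pointwise; apply; exists p.
Qed.

End Pullback.

Section Translations.
Context {R : realType} {n : nat} (G : lieGroupType R n).

(** Left translation by u is multiplication with the first variable frozen; a
chart b around u serves only to name u by its coordinates b u. *)
Lemma left_translation_smooth (u : G) : smooth_map (fun x : G => (u * x)%g).
Proof.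
have [cmul smul] := @lie_group_mul_smooth R n G; split.
  move=> x; apply: (@continuous_comp _ _ _ (pair u) (fun z : G * G => (z.1 * z.2)%g)).
    by apply: cvg_pair => //=; exact: cvg_cst.
  exact: cmul.
move=> c d ac ad k; have [b ab bu] := atlas_cover u.
have /(differentiable_upto_pairl (b u)) := smul b c d ab ac ad k.
rewrite /= chart_mapK // => /differentiable_upto_pointwise dL.
apply/differentiable_upto_pointwise => _ [p [cp dp] <-].
by apply: dL; exists u, p.
Qed.

Lemma right_translation_smooth (u : G) : smooth_map (fun x : G => (x * u)%g).
Proof.
have [cmul smul] := @lie_group_mul_smooth R n G; split.
  move=> x; apply: (@continuous_comp _ _ _ (fun x : G => (x, u))
    (fun z : G * G => (z.1 * z.2)%g)).
    by apply: cvg_pair => //=; exact: cvg_cst.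
  exact: cmul.
move=> c d ac ad k; have [b ab bu] := atlas_cover u.
have /(differentiable_upto_pairr (b u)) := smul c b d ac ab ad k.
rewrite /= chart_mapK // => /differentiable_upto_pointwise dL.
apply/differentiable_upto_pointwise => _ [p [cp dp] <-].
by apply: dL; exists p, u.
Qed.

End Translations.

(** * Fields related by a map *)

(** Composition with F preserves smooth functions.  For fields seen as derivations
this is the form in which smoothness of F is used, and it is immediately stable
under composition. *)
Definition pulls_back_smooth {R : realType} {m n : nat}
    {M : smoothManifoldType R m} {N : smoothManifoldType R n} (F : M -> N) : Prop :=
  forall f : N -> R, smooth_fun f -> smooth_fun (f \o F).

Definition pull {R : realType} {m n : nat} {M : smoothManifoldType R m}
    {N : smoothManifoldType R n} {F : M -> N} (FS : pulls_back_smooth F)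
    (f : smoothfn N) : smoothfn M :=
  SmoothFn (introT (asboolP _) (FS _ (smoothfnP f))).

Section Related.
Context {R : realType} {m n : nat}.

(** F-relatedness determines Y f only at points of the image of F; left
translation brings any point x of H to the point F 1 of this image. *)
Lemma related_unique (G : lieGroupType R m) (H : lieGroupType R n) (F : G -> H)
    (X : lieAlg G) (Y Y' : lieAlg H) :
  pulls_back_smooth F -> related F X Y -> related F X Y' -> Y = Y'.
Proof.
move=> FS XY XY'; apply: lieAlgE => f x.
(* translation by g takes F 1 to x *)
pose g := (x * (F 1%g)^-1)%g.
have gS f' : smooth_fun f' -> smooth_fun (f' \o (fun z : H => g * z)%g).
  exact: smooth_fun_comp (left_translation_smooth g).
have [_ _ Yi] := lieAlgP Y; have [_ _ Y'i] := lieAlgP Y'.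
have -> : x = (g * F 1%g)%g by rewrite /g mulgVK.
rewrite -(Yi g f (pull gS f))// -(Y'i g f (pull gS f))//.
by rewrite -(XY (pull gS f) (pull FS (pull gS f)))// (XY' (pull gS f)).
Qed.

Lemma lie_differentialE (G : lieGroupType R m) (H : lieGroupType R n) (F : G -> H)
    (X : lieAlg G) (Y : lieAlg H) :
  pulls_back_smooth F -> related F X Y -> lie_differential F X = Y.
Proof.
by move=> FS XY; apply: xget_unique => // Y' XY'; exact: related_unique XY' XY.
Qed.

End Related.

(** * The adjoint representation *)

Section Adjoint.
Context {R : realType} {n : nat} {G : lieGroupType R n}.
Implicit Types (u v x y : G) (X Y : lieAlg G) (f : smoothfn G).

Definition conjug u x : G := (u * x * u^-1)%g.

Lemma conjugM u x y : conjug u (x * y)%g = (conjug u x * conjug u y)%g.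
Proof. by rewrite /conjug !mulgA mulgVK. Qed.

Lemma conjugK u : cancel (conjug u) (conjug u^-1%g).
Proof. by move=> x; rewrite /conjug invgK !mulgA mulVg mul1g mulgVK. Qed.

Lemma conjugVK u : cancel (conjug u^-1%g) (conjug u).
Proof. by move=> x; rewrite -{1}[u]invgK conjugK. Qed.

Lemma conjug_smooth u : pulls_back_smooth (conjug u).
Proof.
move=> f fS.
have fR := smooth_fun_comp (right_translation_smooth u^-1%g) fS.
exact: (smooth_fun_comp (left_translation_smooth u) fR).
Qed.

Definition conj_pull u f := pull (conjug_smooth u) f.

Lemma conj_pullK u : cancel (conj_pull u) (conj_pull u^-1%g).
Proof. by move=> f; apply: smoothfnE => x /=; rewrite conjugVK. Qed.

Lemma conj_pullVK u : cancel (conj_pull u^-1%g) (conj_pull u).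
Proof. by move=> f; apply: smoothfnE => x /=; rewrite conjugK. Qed.

Lemma conj_pull_linear u : linear (conj_pull u).
Proof. by move=> a f g; exact: smoothfnE. Qed.

Lemma conj_pullM u f g :
  conj_pull u (smoothfn_mul f g) = smoothfn_mul (conj_pull u f) (conj_pull u g).
Proof. exact: smoothfnE. Qed.

(** Left invariance holds because conjugation turns a left translation by v into
the left translation by the conjugate of v under u^-1. *)
Fact conj_push_subproof u X :
  (fun f => conj_pull u^-1%g (X (conj_pull u f))) \in @left_invariant_pred R n G.
Proof.
have [Xl XM Xi] := lieAlgP X; apply/asboolP; split=> [a f g|f g|v f h hf x].
- by rewrite conj_pull_linear Xl conj_pull_linear.
- rewrite conj_pullM XM -[X in conj_pull _ (X + _)]scale1r conj_pull_linear scale1r.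
  by rewrite !conj_pullM !conj_pullK.
- rewrite /= conjugM; apply: Xi => y.
  by rewrite /= hf conjugM conjugVK.
Qed.

Definition conj_push u X : lieAlg G := LieAlg (conj_push_subproof u X).

Lemma Ad_pushE u X : Ad u X = conj_push u X.
Proof.
apply: lie_differentialE; first exact: conjug_smooth.
move=> f h hf x.
have -> : h = conj_pull u f by apply: smoothfnE.
by rewrite /= -[(u * x * _)%g]/(conjug u x) conjugK.
Qed.

(** The form of [AdE] in which a composite of two fields Ad(u)X and Ad(u)Y
telescopes. *)
Lemma Ad_conj_pull u X f : conj_pull u (Ad u X f) = X (conj_pull u f).
Proof. by rewrite Ad_pushE; apply: smoothfnE => x /=; rewrite conjugK. Qed.

Lemma AdE u X f : Ad u X f = conj_pull u^-1%g (X (conj_pull u f)).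
Proof. by rewrite Ad_pushE. Qed.

Lemma Ad_linear u : linear (Ad u : lieAlg G -> lieAlg G).
Proof.
by move=> a X Y; apply: lieAlgE => f x; rewrite lieAlgDE lieAlgZE !AdE.
Qed.

HB.instance Definition _ u :=
  GRing.isLinear.Build R (lieAlg G) (lieAlg G) *:%R (Ad u) (Ad_linear u).

Lemma AdK u : cancel (Ad u : lieAlg G -> lieAlg G) (Ad u^-1%g).
Proof.
move=> X; apply: lieAlgE => f x.
by rewrite AdE invgK Ad_conj_pull conj_pullVK.
Qed.

Lemma AdVK u : cancel (Ad u^-1%g : lieAlg G -> lieAlg G) (Ad u).
Proof. by move=> X; rewrite -{1}[u]invgK AdK. Qed.

Lemma Ad1 X : Ad 1%g X = X.
Proof.
have pull1 f : conj_pull 1%g f = f.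
  by apply: smoothfnE => x; rewrite /= /conjug mul1g invg1 mulg1.
by apply: lieAlgE => f x; rewrite AdE invg1 !pull1.
Qed.

Lemma Ad_lie u X Y : Ad u [lie X, Y] = [lie Ad u X, Ad u Y].
Proof.
apply: lieAlgE => f x.
rewrite -[RHS]/(Ad u X (Ad u Y f) x - Ad u Y (Ad u X f) x).
by rewrite (AdE u X (Ad u Y f)) (AdE u Y (Ad u X f)) !Ad_conj_pull AdE.
Qed.

Lemma killing_Ad u X Y : killing (Ad u X) (Ad u Y) = killing X Y.
Proof.
exact: (@killing_automorphism _ _ (Ad u) (Ad u^-1%g) X Y (@AdK u) (@AdVK u) (Ad_lie u)).
Qed.

End Adjoint.

(** * Invariance of the Lie algebra of a subgroup *)

Section Subgroup.
Context {R : realType} {n : nat} {U : lieGroupType R n} (L : lieSubgroup U).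
Local Notation incl := (@lsub_incl _ _ _ L).

Lemma incl1 : incl 1%g = 1%g.
Proof. by apply: (mulgI (incl 1%g)); rewrite -lsub_inclM !mulg1. Qed.

Lemma inclV x : incl (x^-1)%g = (incl x)^-1%g.
Proof. by apply: (mulgI (incl x)); rewrite -lsub_inclM !mulgV incl1. Qed.

Lemma incl_conjug u x : incl (conjug u x) = conjug (incl u) (incl x).
Proof. by rewrite /conjug !lsub_inclM inclV. Qed.

Lemma incl_smooth : pulls_back_smooth incl.
Proof. by have [iS _] := lsub_incl_immersion L => f; exact: smooth_fun_comp iS. Qed.

(** The inclusion intertwines conjugation by u in L with conjugation by its image
in U, so it also intertwines the two adjoint actions. *)
Lemma related_incl_Ad u X (Y : lieAlg U) :
  related incl X Y -> related incl (Ad u X) (Ad (incl u) Y).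
Proof.
move=> XY f h hf x; rewrite !AdE /= -inclV -incl_conjug; apply: XY => y.
by rewrite /= hf incl_conjug.
Qed.

(** An element of l is either related to a field on L, and then
[related_incl_Ad] applies, or it is the default value 0 of
[lie_differential]; in the latter case it is the image of 0. *)
Lemma lsub_lieAlg_Ad u (X : lieAlg U) :
  lsub_lieAlg L X -> lsub_lieAlg L (Ad (incl u) X).
Proof.
case=> X' _; rewrite {1}/lie_differential; case: xgetP => [Y -> XY <-|_ <-].
  exists (Ad u X') => //; apply: lie_differentialE; first exact: incl_smooth.
  exact: related_incl_Ad.
rewrite linear0; exists 0 => //; apply: lie_differentialE => [|f h hf x //].
exact: incl_smooth.
Qed.

End Subgroup.

(** * The symplectic form along an orbit *)

Section Orbit.
Context {R : realType} {n : nat} {U : lieGroupType R n}.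
Implicit Types (L : lieSubgroup U) (x X Y : lieAlg U).

(** Each of X and Y enters $<x, [X, Y]>$ only through its bracket with x, by
invariance of the Killing form. *)
Lemma KKS_formE x X Y :
  KKS_form x (fundamental_field X x) (fundamental_field Y x) = killing x [lie X, Y].
Proof.
apply: xget_unique; first by exists X, Y.
move=> _ [X' [Y' [XX' YY' ->]]].
have kx (A B : lieAlg U) : killing x [lie A, B] = - killing (fundamental_field A x) B.
  by rewrite -killing_lie lieC killingC linearN killingC.
(* first X' is exchanged for X, then, after swapping arguments, Y' for Y *)
by rewrite kx -XX' -kx [in LHS]lieC [in RHS]lieC !linearN/= !kx YY'.
Qed.

Lemma derived_sub_perp (A : set (lieAlg U)) x :
  (forall X Y, A X -> A Y -> killing x [lie X, Y] = 0) ->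
  derived_algebra A `<=` killing_perp x.
Proof.
move=> Ax _ [k [c [a [aA ->]]]]; rewrite /killing_perp /= linear_sum big1 // => i _.
by have [X [Y [AX AY ->]]] := aA i; rewrite linearZ /= Ax // mulr0.
Qed.

(** From isotropy to orthogonality it suffices to look at the point x itself; in
the other direction, Ad(u^-1) carries the point Ad(u)x back to x and keeps the
bracket in l'. *)
Lemma isotropic_orbitP L x :
  isotropic_orbit L x <-> derived_algebra (lsub_lieAlg L) `<=` killing_perp x.
Proof.
split=> [iso|perp].
  apply: derived_sub_perp => X Y LX LY; rewrite -KKS_formE.
  (* x lies on its own orbit, as Ad 1 x *)
  apply: iso; [|by exists X|by exists Y].
  exists 1%g; last exact: Ad1.
  by exists 1%g => //; exact: incl1.
move=> _ [_ [u _ <-] <-] _ _ [X LX <-] [Y LY <-].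
rewrite KKS_formE -(killing_Ad (lsub_incl u)^-1%g) AdK Ad_lie.
rewrite -inclV; pose v := (u^-1)%g.
apply: perp; exists 1%N, (fun=> 1), (fun=> [lie Ad (lsub_incl v) X, Ad (lsub_incl v) Y]).
split; last by rewrite big_ord1 scale1r.
move=> _; exists (Ad (lsub_incl v) X), (Ad (lsub_incl v) Y).
by split=> //; exact: lsub_lieAlg_Ad.
Qed.

End Orbit.

Theorem mainTheorem3 (R : realType) (n : nat) (U : lieGroupType R n)
    (compactU : compact [set: U]) (semisimpleU : lie_semisimple (lieAlg U))
    (T : lieSubgroup U) (maxT : maximal_torus T)
    (H0 : complexification (lieAlg U)) (H0_hR : real_cartan (lsub_lieAlg T) H0)
    (iH0 : lieAlg U) (iH0E : complexify iH0 = 'i%C *: H0)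
    (L : lieSubgroup U) (properL : proper_lieSubgroup L) :
  isotropic_orbit L iH0 <->
  derived_algebra (lsub_lieAlg L) `<=` killing_perp iH0.
Proof. exact: isotropic_orbitP. Qed.
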